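(* Fix a prime power $q$ and a real constant $b>0$. Let $m=m(n)$ and $\rho=\rho(n)$ be integer sequences such that $\lim_{n\to\infty} n/m = b$ and $\lim_{n\to\infty}\rho/n = r$. Define $$k(r)=\liminf_{n\to\infty}\frac{\log_{q^m} K_{\mathrm R}(q^m,n,\rho)}{n}.$$ Then for all such $b$ and $r$, $$k(r)=(1-r)(1-br).$$
   Context: For $\mathbf x=(x_0,\dots,x_{n-1})\in\mathrm{GF}(q^m)^n$, the rank $\mathrm{rk}(\mathbf x)$ is the maximum number of coordinates of $\mathbf x$ that are linearly independent over $\mathrm{GF}(q)$; the rank distance is $d_{\mathrm R}(\mathbf x,\mathbf y)=\mathrm{rk}(\mathbf x-\mathbf y)$. The (rank) covering radius of a code $C\subseteq \mathrm{GF}(q^m)^n$ is $\max_{\mathbf x\in\mathrm{GF}(q^m)^n}\min_{\mathbf c\in C} d_{\mathrm R}(\mathbf x,\mathbf c)$. $K_{\mathrm R}(q^m,n,\rho)$ denotes the minimum cardinality of a (linear or nonlinear) code $C\subseteq\mathrm{GF}(q^m)^n$ with rank covering radius $\rho$.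
   Formalization: The formal theorem adds 0 ≤ r ≤ min(1, 1/b), outside which no code has covering radius ρ (or K_R = 1 and the formula fails, e.g. b = 1, r = 2), and reads K_R as the minimum size of a code with covering radius at most ρ. *)

(* Defs.v *)
From HB Require Import structures.
From mathcomp Require Import all_boot all_order all_algebra all_field.
From mathcomp Require Import all_classical all_reals all_analysis.
Set Implicit Arguments. Unset Strict Implicit. Unset Printing Implicit Defensive.
Import Order.TTheory GRing.Theory Num.Theory.
Local Open Scope ring_scope.

(* GF(q) inside a finite field L of order q^m: the fixed field of x |-> x^q. *)
Definition inGFq (L : finFieldType) (q : nat) (a : L) : bool := a ^+ q == a.

Definition coord_indep (L : finFieldType) (q n : nat) (x : 'rV[L]_n)
    (S : {set 'I_n}) : bool :=
  [forall c : {ffun 'I_n -> L},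
     ([forall i, inGFq q (c i)] && (\sum_(i in S) c i * x ord0 i == 0))
       ==> [forall i in S, c i == 0]].

Definition rk (L : finFieldType) (q n : nat) (x : 'rV[L]_n) : nat :=
  \max_(S : {set 'I_n} | coord_indep q x S) #|S|.

Definition rank_dist (L : finFieldType) (q n : nat) (x y : 'rV[L]_n) : nat :=
  rk q (x - y).

Definition covers (L : finFieldType) (q n : nat) (C : {set 'rV[L]_n}) (rho : nat) : bool :=
  [forall x : 'rV[L]_n, [exists c in C, rank_dist q x c <= rho]]%N.

Definition KR (L : finFieldType) (q n rho : nat) : nat :=
  \big[minn/#|'rV[L]_n|]_(C : {set 'rV[L]_n} | covers q C rho) #|C|.

Definition prime_power (q : nat) : Prop :=
  exists p e : nat, [/\ prime p, (0 < e)%N & q = (p ^ e)%N].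

(* Main.v *)
(* Up to a factor q^n the minimal cardinality K is q^((m - rho)(n - rho)), which
   determines the limit because n is negligible against mn.

   Lower bound: a vector of rank at most rho is determined by a set S of rho
   coordinates, its values there, and the (n - rho) * rho elements of GF(q)
   expressing the other coordinates in terms of these, so a ball of radius rho has
   at most 2^n * q^(m rho + (n - rho) rho) elements, and the balls around the
   codewords cover the space.

   Upper bound: let u_0, ..., u_(m-1) be a GF(q)-basis of GF(q^m).  The code of all
   c with c_j in {0, u_j} for j < rho, and c_j in the span W of u_rho, ..., u_(m-1)
   for j >= rho, covers: by the exchange lemma one can choose c_0, ..., c_(rho-1) one
   after the other so that y_j = x_j - c_j can replace u_j in the basis; the other
   x_j are then, modulo W, combinations of y_0, ..., y_(rho-1), so that x - c has all
   its coordinates in the span of these rho elements. *)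
Require Import Defs.
From HB Require Import structures.
From mathcomp Require Import all_boot all_order all_algebra all_field.
From mathcomp Require Import all_classical all_reals all_analysis.
From mathcomp Require Import ring lra.
Import Order.TTheory GRing.Theory Num.Theory.
Import numFieldNormedType.Exports.
Set Implicit Arguments. Unset Strict Implicit. Unset Printing Implicit Defensive.
Local Open Scope ring_scope.

(** * Preliminaries on polynomials, finite sets and the minimum [KR] *)

Lemma prime_power_gt1 q : prime_power q -> (1 < q)%N.
Proof.
move=> [p [e [p_pr e_gt0 ->]]].
by rewrite -(expn0 p) ltn_exp2l ?prime_gt1.
Qed.

(** By induction, since a - b divides a^q - b^q, applied to a = X^(q^m) and b = X. It serves to
    split X^q - X over [L]. *)
Lemma dvdp_subXq (L : idomainType) (q m : nat) :
  ('X^q - 'X : {poly L}) %| ('X^(q ^ m) - 'X).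
Proof.
elim: m => [|m IHm]; first by rewrite expn0 subrr dvdp0.
have -> : 'X^(q ^ m.+1) - 'X = ('X^(q ^ m)) ^+ q - 'X^q + ('X^q - 'X) :> {poly L}.
  by rewrite addrA subrK -exprM expnSr.
by rewrite dvdp_add // subrXX dvdp_mulr.
Qed.

Lemma card_extend (T : finType) (S : {set T}) k : (#|S| <= k <= #|T|)%N ->
  exists2 S' : {set T}, S \subset S' & #|S'| = k.
Proof.
elim: k => [|k IHk].
  by rewrite leqn0 => /andP[/eqP cS _]; exists S.
case/andP; rewrite leq_eqVlt => /orP[/eqP cS _|]; first by exists S.
rewrite ltnS => cS kT; have [|S' sS cS'] := IHk; first by rewrite cS ltnW.
have : ~~ (T \subset S').
  by apply/negP => /subset_leq_card; rewrite cS' leqNgt kT.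
move=> /subsetPn[j _ jS'].
exists (j |: S'); last by rewrite cardsU1 jS' cS'.
by apply: fintype.subset_trans sS _; apply: finset.subsetUr.
Qed.

Lemma leq_card_bigcup (I T : finType) (P : pred I) (X : I -> {set T}) :
  (#|(\bigcup_(i | P i) X i)%SET| <= \sum_(i | P i) #|X i|)%N.
Proof.
elim/big_rec2: _ => [|i s A _ le_sA]; first by rewrite cards0.
by apply: leq_trans (leq_card_setU _ _) _; rewrite leq_add2l.
Qed.

Lemma KR_le_card (L : finFieldType) (q n rho : nat) (C : {set 'rV[L]_n}) :
  covers q C rho -> (KR L q n rho <= #|C|)%N.
Proof.
move=> covC; rewrite /KR -Order.NatOrder.minEnat -Order.NatOrder.leEnat.
exact: bigmin_le_cond.
Qed.

Lemma leq_KR (L : finFieldType) (q n rho k : nat) :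
  (k <= #|'rV[L]_n|)%N ->
  (forall C : {set 'rV[L]_n}, covers q C rho -> (k <= #|C|)%N) ->
  (k <= KR L q n rho)%N.
Proof.
by move=> k_le k_leC; apply: (big_ind (leq k)) => // a b ka kb; rewrite leq_min ka.
Qed.

(** * The subfield GF(q) of [L] *)

Section GFq.
Variables (L : finFieldType) (q m : nat).
Hypotheses (q_pp : prime_power q) (cardL : #|L| = (q ^ m)%N).

Local Notation F := (@inGFq L q).

Let q_gt1 : (1 < q)%N. Proof. exact: prime_power_gt1. Qed.

Let exp2_le n : (2 ^ n <= q ^ n)%N. Proof. by case: n => // n; rewrite leq_exp2r. Qed.

(** With q = p^e the order of [L] is p^(em), so p is the characteristic. This makes the q-th power
    map additive, hence its fixed points closed under sums. *)
Lemma pchar_nat_q : [pchar L].-nat q.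
Proof.
case: q_pp => p [e [p_pr e_gt0 qE]].
rewrite qE pnatX pnatE //; apply/orP; left.
by apply: (@card_finPcharP _ p (e * m)) => //; rewrite cardL qE expnM.
Qed.

Lemma inGFq0 : F 0.
Proof. by rewrite /inGFq expr0n gtn_eqF // ltnW. Qed.

Lemma inGFq1 : F 1.
Proof. by rewrite /inGFq expr1n. Qed.

Lemma inGFqM a b : F a -> F b -> F (a * b).
Proof. by rewrite /inGFq exprMn => /eqP-> /eqP->. Qed.

Lemma inGFqV a : F a -> F a^-1.
Proof. by rewrite /inGFq exprVn => /eqP->. Qed.

Lemma inGFqD a b : F a -> F b -> F (a + b).
Proof.
by rewrite /inGFq exprDn_pchar ?pchar_nat_q // => /eqP-> /eqP->.
Qed.

Lemma inGFqN a : F a -> F (- a).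
Proof. by rewrite /inGFq exprNn_pchar ?pchar_nat_q // => /eqP->. Qed.

Lemma inGFqB a b : F a -> F b -> F (a - b).
Proof. by move=> Fa Fb; apply: inGFqD => //; apply: inGFqN. Qed.

(** X^q - X divides X^(q^m) - X, the product of all X - a for a in [L]. It is thus, up to a unit, a
    product of distinct linear factors; their number is its degree q, and its roots are the fixed
    points of the q-th power map. *)
Lemma card_inGFq : #|F| = q.
Proof.
have size_Xq : size ('X^q - 'X : {poly L}) = q.+1.
  by rewrite size_polyDl ?size_polyXn // size_polyN size_polyX.
have := dvdp_subXq L q m; rewrite -cardL finField_genPoly.
move=> /dvdp_prod_XsubC[s].
set r := mask _ _ => eq_r.
have r_uniq : uniq r by rewrite mask_uniq ?index_enum_uniq.
have rE : r =i F.
  move=> a; rewrite -root_prod_XsubC -(eqp_root eq_r) rootE !hornerE subr_eq0.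
  by [].
have size_r : size r = q.
  by have := eqp_size eq_r; rewrite size_Xq size_prod_XsubC => -[].
by rewrite -[RHS]size_r -(card_uniqP r_uniq); apply: eq_card => a; rewrite rE.
Qed.

#[local] Hint Resolve inGFq0 inGFq1 : core.

(** * Independence of coordinates over GF(q) *)

Lemma coord_indepP n (x : 'rV[L]_n) (S : {set 'I_n}) :
  reflect (forall c : 'I_n -> L, (forall i, F (c i)) ->
             \sum_(i in S) c i * x ord0 i = 0 -> forall i, i \in S -> c i = 0)
          (coord_indep q x S).
Proof.
apply: (iffP forallP) => [indep c Fc sum0 i iS | indep c].
  have /implyP := indep (finfun c).
  have -> : [forall i, inGFq q (finfun c i)].
    by apply/forallP => j; rewrite ffunE; apply: Fc.
  have -> : \sum_(i in S) finfun c i * x ord0 i == 0.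
    by apply/eqP; rewrite -[RHS]sum0; apply: eq_bigr => j _; rewrite ffunE.
  by move=> /(_ isT) /forall_inP /(_ i iS); rewrite ffunE => /eqP.
apply/implyP => /andP[/forallP Fc /eqP sum0].
by apply/forall_inP => i iS; apply/eqP; apply: indep sum0 i iS.
Qed.

(** Counting replaces dimension theory: the q^|S| combinations of the independent coordinates are
    distinct, and all lie among the at most q^N combinations of the [y i]. *)
Lemma card_indep_le n N (x : 'rV[L]_n) (y : nat -> L) (a : 'I_n -> nat -> L) S :
  (forall j i, F (a j i)) ->
  (forall j, x ord0 j = \sum_(i < N) a j i * y i) ->
  coord_indep q x S -> (#|S| <= N)%N.
Proof.
move=> Fa xE /coord_indepP indepS.
pose D := [set c in pffun_on 0 S F].
pose E := [set c : {ffun 'I_N -> L} in ffun_on F].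
pose f (c : {ffun 'I_n -> L}) := \sum_(i in S) c i * x ord0 i.
pose g (c : {ffun 'I_N -> L}) := \sum_i c i * y i.
have cD : #|D| = (q ^ #|S|)%N by rewrite cardsE card_pffun_on card_inGFq.
have cE : #|E| = (q ^ N)%N by rewrite cardsE card_ffun_on card_inGFq card_ord.
rewrite -(leq_exp2l _ _ q_gt1) -cD -cE.
have DP c : c \in D -> (forall i, F (c i)) /\ (forall i, i \notin S -> c i = 0).
  rewrite inE => /pffun_onP[/supportP supp img].
  split=> i; last by move=> iS; apply: supp.
  have [iS|iS] := boolP (i \in S); last by rewrite supp.
  by apply: img; apply: fintype.image_f.
have injf : {in D &, injective f}.
  move=> c d /DP[Fc c0] /DP[Fd d0] fcd; apply/ffunP => i.
  have [iS|iS] := boolP (i \in S); last by rewrite c0 ?d0.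
  apply/eqP; rewrite -subr_eq0; apply/eqP.
  apply: (indepS (fun i => c i - d i)) => // [j|]; first exact: inGFqB.
  rewrite -[RHS](subrr (f c)) {2}fcd /f -sumrB.
  by apply: eq_bigr => j _; rewrite mulrBl.
rewrite -(card_in_imset injf); apply: leq_trans (leq_imset_card g E).
apply/subset_leq_card/fintype.subsetP => _ /imsetP[c /DP[Fc _] ->].
apply/imsetP; exists [ffun i : 'I_N => \sum_(j in S) c j * a j i].
  rewrite inE; apply/ffun_onP => i; rewrite ffunE.
  by apply: (big_ind F) => // [u v Fu Fv|j _]; [apply: inGFqD|apply: inGFqM].
rewrite /f /g.
under [RHS]eq_bigr do rewrite ffunE mulr_suml.
rewrite exchange_big /=; apply: eq_bigr => j _.
by rewrite xE mulr_sumr; apply: eq_bigr => i _; rewrite mulrA.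
Qed.

(** * Spanning families over GF(q) and the exchange lemma *)

Definition spans (u : nat -> L) k :=
  forall z, exists2 c : nat -> L, (forall i, F (c i)) & z = \sum_(i < k) c i * u i.

Lemma eq_spans u v k : (forall i, (i < k)%N -> u i = v i) -> spans u k -> spans v k.
Proof.
move=> uv su z; have [c Fc ->] := su z; exists c => //.
by apply: eq_bigr => i _; rewrite uv.
Qed.

Lemma spansS u k : spans u k -> spans u k.+1.
Proof.
move=> su z; have [c Fc ->] := su z.
exists (fun i => if i == k then 0 else c i); first by move=> i; case: ifP.
rewrite big_ord_recr /= eqxx mul0r addr0; apply: eq_bigr => i _.
by rewrite ltn_eqF.
Qed.

Lemma spans_exchange y N c k : spans y N -> (forall i, F (c i)) -> (k < N)%N ->
  c k != 0 -> spans (fun i => if i == k then \sum_(j < N) c j * y j else y i) N.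
Proof.
move=> sy Fc kN ck0 z; have [d Fd ->] := sy z.
(* Solve the new vector for [y k], which is possible as [c k] is nonzero, and substitute into the
   expansion of [z]. *)
exists (fun i => if i == k then d k / c k else d i - d k / c k * c i).
  by move=> i; case: ifP => _; rewrite ?inGFqB ?inGFqM ?inGFqV.
pose k' := Ordinal kN.
rewrite (bigD1 k') // [RHS](bigD1 k') //= eqxx [in RHS](bigD1 k') //=.
rewrite mulrDr mulrA divfK // -addrA; congr (_ + _).
rewrite mulr_sumr -big_split /=; apply: eq_bigr => i ik.
have /negPf -> : (i : nat) != k by [].
by rewrite mulrBl !mulrA addrC subrK.
Qed.

(** Induction on k: the vectors with index below k are already exchanged, and [u k] is exchanged
    next. This works as soon as the coefficient of [u k] in the new vector is nonzero. *)
Lemma spans_shift u N (x : nat -> L) k : spans u N -> (k <= N)%N ->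
  exists e : nat -> bool,
    spans (fun i => if (i < k)%N then x i - (e i)%:R * u i else u i) N.
Proof.
move=> su; elim: k => [|k IHk] kN; first by exists (fun=> false).
have [e se] := IHk (ltnW kN).
set y := (fun i : nat => _) in se.
have [c Fc xk] := se (x k).
have yk : y k = u k by rewrite /y ltnn.
(* Subtract [u k] exactly when its coefficient in [x k] vanishes; the coefficient [d k] is then -1,
   and otherwise it is [c k]. *)
pose b := c k == 0.
pose d i := c i - (b && (i == k))%:R.
have dk0 : d k != 0.
  rewrite /d eqxx andbT /b; case: (eqVneq (c k) 0) => [->|]; last by rewrite subr0.
  by rewrite sub0r oppr_eq0 oner_neq0.
have Fd i : F (d i) by apply: inGFqB => //; case: (b && _).
exists (fun i => if i == k then b else e i).
apply: (eq_spans _ (spans_exchange se Fd kN dk0)) => i iN.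
have [->|ik] := eqVneq i k; last first.
  by rewrite /y ltnS [(i <= k)%N]leq_eqVlt (negPf ik).
rewrite ltnSn xk /d.
under eq_bigr do rewrite mulrBl.
rewrite sumrB; congr (_ - _).
rewrite (bigD1 (Ordinal kN)) //= eqxx andbT yk big1 ?addr0 // => j jk.
by have /negPf -> : (j : nat) != k by []; rewrite andbF mul0r.
Qed.

(** An independent family grows by any element outside its span until it spans or has length m. In
    the latter case its q^m combinations are distinct, so they exhaust [L]. *)
Lemma spans_exists : exists u, spans u m.
Proof.
pose indep (u : nat -> L) k := forall c : nat -> L, (forall i, F (c i)) ->
  \sum_(i < k) c i * u i = 0 -> forall i, (i < k)%N -> c i = 0.
have step k : (exists u, spans u k) \/ (exists u, indep u k).
  elim: k => [|k [[u su]|[u iu]]]; first by right; exists (fun=> 0).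
    by left; exists u; apply: spansS.
  have [su|/existsNP[z Nz]] := pselect (spans u k).
    by left; exists u; apply: spansS.
  right; exists (fun i => if i == k then z else u i) => c Fc.
  rewrite big_ord_recr /= eqxx.
  under eq_bigr => i _ do rewrite ltn_eqF //.
  move=> sum0.
  have ck : c k = 0.
    apply/eqP/negPn/negP => ck0; apply: Nz.
    exists (fun i => - (c k)^-1 * c i) => [i|]; first by rewrite inGFqM ?inGFqN ?inGFqV.
    under eq_bigr do rewrite -mulrA.
    move/eqP: sum0; rewrite -mulr_sumr addrC addr_eq0 => /eqP ckz.
    by rewrite mulNr -mulrN -ckz mulKf.
  move: sum0; rewrite ck mul0r addr0 => sum0 i.
  by rewrite ltnS leq_eqVlt => /orP[/eqP->//|]; apply: iu.
have [//|[u iu]] := step m; exists u.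
pose K := {a : L | F a}.
pose f (c : {ffun 'I_m -> K}) := \sum_i val (c i) * u i.
have injf : injective f.
  move=> c d fcd; apply/ffunP => i; apply: val_inj.
  (* The default [i] is harmless: only indices below m enter the sum. *)
  pose h j := val (c (insubd i j)) - val (d (insubd i j)).
  have hE (j : 'I_m) : h j = val (c j) - val (d j) by rewrite /h valKd.
  apply/eqP; rewrite -subr_eq0 -hE; apply/eqP.
  apply: (iu h) => // [j|]; first by apply: inGFqB; apply: valP.
  rewrite -[RHS](subrr (f c)) {2}fcd /f -sumrB.
  by apply: eq_bigr => j _; rewrite hE mulrBl.
move=> z; have : z \in codom f.
  by apply: inj_card_onto => //; rewrite cardL card_ffun card_ord card_sig card_inGFq.
move=> /codomP[c ->].
exists (fun i => if insub i is Some j then val (c j) else 0).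
  by move=> i; case: insubP => // j _ _; apply: valP.
by apply: eq_bigr => i _; rewrite valK.
Qed.

(** * Rank and the size of balls *)

Lemma rk_attained n (x : 'rV[L]_n) : exists2 S, coord_indep q x S & rk q x = #|S|.
Proof.
have indep0 : coord_indep q x finset.set0.
  by apply/coord_indepP => c _ _ i; rewrite inE.
have [|S indepS rkE] := @eq_bigmax_cond _ (coord_indep q x) (fun S => #|S|).
  by apply/card_gt0P; exists finset.set0.
by exists S.
Qed.

Lemma rk_le n (x : 'rV[L]_n) : (rk q x <= n)%N.
Proof.
by have [S _ ->] := rk_attained x; rewrite -[leqRHS](card_ord n) max_card.
Qed.

Lemma rk_le_span n N (x : 'rV[L]_n) (y : nat -> L) (a : 'I_n -> nat -> L) :
  (forall j i, F (a j i)) ->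
  (forall j, x ord0 j = \sum_(i < N) a j i * y i) -> (rk q x <= N)%N.
Proof.
have [S indepS ->] := rk_attained x => Fa xE.
exact: (card_indep_le Fa xE indepS).
Qed.

(** A maximal independent set S expresses every other coordinate: adding j gives a relation, whose
    coefficient at j is nonzero because S is independent. S is then padded to exactly rho
    coordinates, with coefficient 0 on the added ones, so that later counts depend on rho only. *)
Lemma rk_le_support n rho (x : 'rV[L]_n) : (rk q x <= rho <= n)%N ->
  exists2 S : {set 'I_n}, #|S| = rho &
  exists2 a : 'I_n -> 'I_n -> L, (forall j i, F (a j i)) &
    forall j, x ord0 j = \sum_(i in S) a j i * x ord0 i.
Proof.
move=> /andP[rk_rho rho_n].
have [S indepS rkE] := rk_attained x.
have spanS j : exists2 c : 'I_n -> L, (forall i, F (c i)) &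
    x ord0 j = \sum_(i in S) c i * x ord0 i.
  have [jS|jS] := boolP (j \in S).
    exists (fun i => (i == j)%:R); first by move=> i; case: (_ == _).
    rewrite (bigD1 j) //= eqxx mul1r big1 ?addr0 // => i /andP[_ /negPf->].
    by rewrite mul0r.
  have : ~~ coord_indep q x (j |: S).
    apply/negP => indep_jS.
    have := @leq_bigmax_cond _ (coord_indep q x) (fun S => #|S|) _ indep_jS.
    by rewrite -/(rk q x) rkE cardsU1 jS ltnn.
  move=> /forallPn[c]; rewrite negb_imply -andbA => /and3P[/forallP Fc].
  rewrite big_setU1 //= addr_eq0 => /eqP sum0 /forall_inPn[i ijS ci0].
  have cj0 : c j != 0.
    apply: contra ci0 => /eqP cj0; move: ijS; rewrite !inE => /orP[/eqP->|iS].
      by rewrite cj0.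
    move: sum0; rewrite cj0 mul0r => /eqP; rewrite eq_sym oppr_eq0 => /eqP sum0.
    by apply/eqP; apply: (elimT (coord_indepP _ _) indepS) sum0 i iS.
  exists (fun i => - (c j)^-1 * c i) => [k|]; first by rewrite inGFqM ?inGFqN ?inGFqV.
  under eq_bigr do rewrite -mulrA.
  by rewrite -mulr_sumr mulNr -mulrN -sum0 mulKf.
have [|S' sS cS'] := @card_extend _ S rho.
  by rewrite -rkE rk_rho card_ord.
exists S' => //.
have [a Fa xE] := fin_all_exists2 spanS.
exists (fun j i => if i \in S then a j i else 0) => [j i|j].
  by case: ifP.
rewrite [LHS]xE [RHS](big_setID S) /= (finset.setIidPr sS) [X in _ + X]big1 ?addr0.
  by apply: eq_bigr => i ->.
by move=> i; rewrite inE => /andP[/negPf-> _]; rewrite mul0r.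
Qed.

Lemma card_ball_le n rho : (rho <= n)%N ->
  (#|[set x : 'rV[L]_n | rk q x <= rho]| <=
     2 ^ n * q ^ (m * rho + (n - rho) * rho))%N.
Proof.
move=> rho_n.
pose D (S : {set 'I_n}) : {set {ffun 'I_n -> L} * {ffun 'I_n * 'I_n -> L}} :=
  finset.setX [set y in pffun_on 0 S L]
    [set A in pffun_on 0 (finset.setX (finset.setC S) S) F].
(* [f] decodes: the first component of [yA] holds the values on S, the second the coefficients for
   the coordinates outside S. *)
pose f (S : {set 'I_n}) (yA : {ffun 'I_n -> L} * {ffun 'I_n * 'I_n -> L}) :=
  \row_j (if j \in S then yA.1 j else \sum_(i in S) yA.2 (j, i) * yA.1 i).
pose P (S : {set 'I_n}) := #|S| == rho.
have sub_ball : [set x : 'rV[L]_n | rk q x <= rho]%N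
    \subset (\bigcup_(S | P S) [set f S yA | yA in D S])%SET.
  apply/fintype.subsetP => x; rewrite inE => rk_x.
  have [|S cS [a Fa xE]] := @rk_le_support _ rho x; first by rewrite rk_x.
  apply/finset.bigcupP; exists S; first by rewrite /P cS.
  apply/imsetP.
  exists ([ffun i => if i \in S then x ord0 i else 0],
    [ffun ji => if ji \in finset.setX (finset.setC S) S then a ji.1 ji.2 else 0]).
    rewrite !inE; apply/andP; split; apply/pffun_onP; split.
    - by apply/supportP => i /negPf iS; rewrite ffunE iS.
    - by move=> y _.
    - by apply/supportP => i /negPf iS; rewrite ffunE iS.
    - by move=> _ /mapP[i _ ->]; rewrite ffunE; case: ifP => _; [apply: Fa|apply: inGFq0].
  apply/rowP => j; rewrite !mxE /=; case: ifPn => jS; first by rewrite ffunE jS.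
  have -> : x 0 j = x ord0 j by [].
  rewrite xE; apply: eq_bigr => i iS.
  by rewrite !ffunE !inE /= jS iS.
apply: leq_trans (subset_leq_card sub_ball) _.
apply: leq_trans (leq_card_bigcup _ _) _.
apply: (@leq_trans (\sum_(S | P S) q ^ (m * rho + (n - rho) * rho))).
  apply: leq_sum => S /eqP cS; apply: leq_trans (leq_imset_card _ _) _.
  rewrite cardsX !cardsE !card_pffun_on card_inGFq cardL cardsX.
  by rewrite cardsCs finset.setCK card_ord cS -expnM -expnD.
(* The number of choices for S is bounded crudely by that of all subsets. *)
rewrite sum_nat_const leq_mul2r; apply/orP; right.
rewrite -[X in (_ <= 2 ^ X)%N]card_ord -cardsT -card_powerset.
by apply/subset_leq_card/fintype.subsetP => S _; rewrite powersetE finset.subsetT.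
Qed.

(** * Lower bound by sphere covering *)

Lemma covers_card n rho (C : {set 'rV[L]_n}) : covers q C rho ->
  (q ^ (m * n) <= #|C| * #|[set x : 'rV[L]_n | rk q x <= rho]|)%N.
Proof.
move=> /forallP covC.
have -> : (q ^ (m * n) = #|'rV[L]_n|)%N by rewrite card_mx cardL mul1n expnM.
(* Codeword plus error maps [C] times the ball onto the whole space. *)
rewrite -cardsX; apply: leq_trans (leq_imset_card (fun u => u.1 + u.2) _).
rewrite -cardsT; apply/subset_leq_card/fintype.subsetP => x _.
have /existsP[c /andP[cC dxc]] := covC x.
apply/imsetP; exists (c, x - c); last by rewrite addrC subrK.
by rewrite !inE cC.
Qed.

Lemma KR_gt0 n rho : (0 < KR L q n rho)%N.
Proof.
apply: leq_KR => [|C /forallP/(_ 0)/existsP[c /andP[cC _]]].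
  by apply/card_gt0P; exists 0.
by apply/card_gt0P; exists c.
Qed.

(* Truncated subtraction: for rho >= m or rho >= n this only says 0 < KR. *)
Lemma KR_lower n rho : (q ^ ((m - rho) * (n - rho)) <= KR L q n rho * q ^ n)%N.
Proof.
have q_gt0 := ltnW q_gt1.
have [n_rho|rho_n] := leqP n rho.
  by rewrite (eqP n_rho) muln0 muln_gt0 KR_gt0 expn_gt0 q_gt0.
have [m_rho|rho_m] := leqP m rho.
  by rewrite (eqP m_rho) mul0n muln_gt0 KR_gt0 expn_gt0 q_gt0.
have mnE : (m * n = (m - rho) * (n - rho) + (m * rho + (n - rho) * rho))%N.
  have -> : (m * n = m * (n - rho) + m * rho)%N by rewrite -mulnDr subnK 1?ltnW.
  have -> : (m * (n - rho) = (m - rho) * (n - rho) + (n - rho) * rho)%N.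
    by rewrite [((n - rho) * rho)%N]mulnC -mulnDl subnK 1?ltnW.
  by rewrite -addnA [((n - rho) * rho + _)%N]addnC.
suff le_card (C : {set 'rV[L]_n}) : (q ^ (m * n) <=
    #|C| * #|[set x : 'rV[L]_n | rk q x <= rho]|)%N ->
    (q ^ ((m - rho) * (n - rho)) <= #|C| * q ^ n)%N.
  (* Induction over the minimum: its value is the size of some set satisfying the bound. The default
     value is the size of the whole space, which satisfies it because the ball contains 0. *)
  have [C covC <-] : exists2 C : {set 'rV[L]_n},
      (q ^ ((m - rho) * (n - rho)) <= #|C| * q ^ n)%N & #|C| = KR L q n rho.
    rewrite /KR; elim/big_ind: _ => [|a b [C hC <-] [C' hC' <-]|C /covers_card].
    - exists finset.setT; last by rewrite cardsT.
      apply: le_card; rewrite cardsT card_mx cardL mul1n -expnM leq_pmulr //.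
      apply/card_gt0P; exists 0; rewrite inE.
      apply: (@rk_le_span _ _ _ (fun=> 0) (fun _ _ => 0)) => // j.
      by rewrite mxE big1 // => i _; rewrite mul0r.
    - by rewrite /minn; case: ifP => _; [exists C|exists C'].
    - by move=> /le_card; exists C.
  exact: covC.
move=> hC; have := leq_trans hC (leq_mul (leqnn _) (card_ball_le (ltnW rho_n))).
rewrite mnE expnD !mulnA leq_pmul2r ?expn_gt0 ?q_gt0 // => hC'.
by apply: leq_trans hC' _; rewrite leq_mul2l exp2_le orbT.
Qed.

(** * Upper bound by an explicit code *)

Lemma card_ord_ge n k : #|[set j : 'I_n | (k <= j)%N]| = (n - k)%N.
Proof.
rewrite -sum1_card -[RHS]muln1 -sum_nat_const_nat big_geq_mkord /=.
by apply: eq_bigl => i; rewrite inE.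
Qed.

Lemma KR_upper n rho : (KR L q n rho <= q ^ (n + (m - rho) * (n - rho)))%N.
Proof.
have q_gt0 := ltnW q_gt1.
(* If rho is at least n or m, every vector has rank at most rho and the code {0} covers. *)
have KR_le1 : (forall x : 'rV[L]_n, rk q x <= rho)%N ->
    (KR L q n rho <= q ^ (n + (m - rho) * (n - rho)))%N.
  move=> rk_rho; apply: (@leq_trans 1); last by rewrite expn_gt0 q_gt0.
  rewrite -(cards1 (0 : 'rV[L]_n)); apply: KR_le_card.
  apply/forallP => x; apply/existsP; exists 0.
  by rewrite inE eqxx /= /rank_dist subr0.
have [n_rho|rho_n] := leqP n rho.
  by apply: KR_le1 => x; apply: leq_trans (rk_le x) n_rho.
have [u su] := spans_exists.
have [m_rho|rho_m] := leqP m rho.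
  apply: KR_le1 => x; apply: leq_trans m_rho.
  have [c Fc xE] := fin_all_exists2 (fun j : 'I_n => su (x ord0 j)).
  exact: (rk_le_span Fc xE).
pose J : {set 'I_n * 'I_m} :=
  finset.setX [set j : 'I_n | (rho <= j)%N] [set i : 'I_m | (rho <= i)%N].
pose D : {set {ffun 'I_n -> bool} * {ffun 'I_n * 'I_m -> L}} :=
  finset.setX finset.setT [set A in pffun_on 0 J F].
(* The code is the image of [f]. The bits [eA.1] range over all n positions although only the first
   rho are read; the resulting factor 2^n is absorbed in q^n. *)
pose f (eA : {ffun 'I_n -> bool} * {ffun 'I_n * 'I_m -> L}) : 'rV[L]_n :=
  \row_j (if (j < rho)%N then (eA.1 j)%:R * u j
          else \sum_(i < m | (rho <= i)%N) eA.2 (j, i) * u i).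
have cardD : (#|[set f eA | eA in D]%SET| <= q ^ (n + (m - rho) * (n - rho)))%N.
  apply: leq_trans (leq_imset_card _ _) _.
  rewrite cardsX cardsT card_ffun card_bool card_ord cardsE card_pffun_on card_inGFq.
  rewrite cardsX !card_ord_ge expnD [((m - rho) * _)%N]mulnC leq_mul2r.
  by rewrite exp2_le orbT.
apply: leq_trans cardD; apply: KR_le_card; apply/forallP => x.
(* Extension by 0, since [spans_shift] takes sequences indexed by [nat]. *)
pose x' i := if insub i is Some j then x ord0 j else 0.
have x'E (j : 'I_n) : x' j = x ord0 j by rewrite /x' valK.
have [e se] := spans_shift x' su (ltnW rho_m).
set y := (fun i : nat => _) in se.
have [d Fd xE] := fin_all_exists2 (fun j : 'I_n => se (x ord0 j)).
pose A := [ffun ji : 'I_n * 'I_m => if ji \in J then d ji.1 ji.2 else 0].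
apply/existsP; exists (f ([ffun j : 'I_n => e j], A)); apply/andP; split.
  apply/imsetP; exists ([ffun j : 'I_n => e j], A) => //.
  rewrite !inE; apply/pffun_onP; split.
    by apply/supportP => i /negPf iJ; rewrite ffunE iJ.
  by move=> _ /mapP[i _ ->]; rewrite ffunE; case: ifP => _; [apply: Fd|apply: inGFq0].
apply: (@rk_le_span _ _ _ y
  (fun j i => if (j < rho)%N then (i == j)%:R else d j i)) => [j i|j].
  by case: ifP => // _; case: (_ == _).
rewrite !mxE /=; case: ifPn => j_rho.
  rewrite (bigD1 (Ordinal j_rho)) //= eqxx mul1r big1 ?addr0; last first.
    by move=> i ij; have /negPf -> : (i : nat) != j by []; rewrite mul0r.
  by rewrite /y j_rho x'E ffunE.
have -> : x 0 j = x ord0 j by [].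
(* In the expansion of [x j], the terms with index at least rho involve [y i] = [u i] and are
   exactly the codeword's coordinate, so only the first rho terms survive. *)
rewrite xE (bigID (fun i : 'I_m => (i < rho)%N)) /=.
rewrite -(big_ord_widen _ (fun i => d j i * y i) (ltnW rho_m)).
under [X in _ - X]eq_bigl do rewrite leqNgt.
rewrite [X in _ + X - _](_ : _ = \sum_(i < m | ~~ (i < rho)%N) A (j, i) * u i) ?addrK //.
apply: eq_bigr => i i_rho.
by rewrite /y (negPf i_rho) ffunE !inE /= (leqNgt rho j) (leqNgt rho i) j_rho i_rho.
Qed.

End GFq.

(** * Asymptotics *)

Local Open Scope classical_set_scope.

Lemma ln_KR_bounds (R : realType) (L : finFieldType) (q m n rho : nat) :
  prime_power q -> #|L| = (q ^ m)%N ->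
  ((m - rho) * (n - rho))%:R * ln (q%:R : R) - n%:R * ln q%:R
    <= ln ((KR L q n rho)%:R : R)
    <= ((m - rho) * (n - rho))%:R * ln q%:R + n%:R * ln q%:R.
Proof.
move=> q_pp cardL.
have q_gt0 : (0 < q%:R :> R) by rewrite ltr0n ltnW // prime_power_gt1.
have K_gt0 : (0 < (KR L q n rho)%:R :> R) by rewrite ltr0n KR_gt0.
have lo : ln (q%:R ^+ ((m - rho) * (n - rho))) <=
    ln ((KR L q n rho)%:R * q%:R ^+ n) :> R.
  rewrite ler_ln ?posrE ?mulr_gt0 ?exprn_gt0 //.
  by rewrite -!natrX -natrM ler_nat (KR_lower q_pp cardL).
have hi : ln (KR L q n rho)%:R <= ln (q%:R ^+ (n + (m - rho) * (n - rho))) :> R.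
  by rewrite ler_ln ?posrE ?exprn_gt0 // -natrX ler_nat (KR_upper q_pp cardL).
move: lo hi; rewrite lnM ?posrE ?exprn_gt0 // !lnXn // -![ln _ *+ _]mulr_natl natrD.
by move=> lo hi; apply/andP; split; lra.
Qed.

(** [f n] may exceed [g n] even though l <= 1, so the truncated ratio is the positive part (t +
    |t|)/2 of t = 1 - f/g. This is continuous in t, and 1 - l is its own positive part. *)
Lemma cvg_subn_ratio (R : realType) (f g : nat -> nat) (l : R) :
  (\forall n \near \oo, (0 < g n)%N) -> l <= 1 ->
  (fun n => (f n)%:R / (g n)%:R : R) @ \oo --> l ->
  (fun n => (g n - f n)%:R / (g n)%:R : R) @ \oo --> 1 - l.
Proof.
move=> g_gt0 l_le1 fg_l.
pose t n : R := 1 - (f n)%:R / (g n)%:R.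
have t_l : t @ \oo --> 1 - l by apply: cvgB => //; exact: cvg_cst.
have -> : 1 - l = 2^-1 * ((1 - l) + `|1 - l|).
  by rewrite ger0_norm ?subr_ge0 //; lra.
have : (fun n => 2^-1 * (t n + `|t n|)) @ \oo --> 2^-1 * ((1 - l) + `|1 - l|).
  by apply: cvgMr; apply: cvgD => //; exact: cvg_norm.
apply: cvg_trans; apply: near_eq_cvg; near=> n.
have gn : (0 < (g n)%:R :> R) by rewrite ltr0n; near: n.
have tE : t n = ((g n)%:R - (f n)%:R) / (g n)%:R.
  by rewrite /t mulrBl divff // gt_eqF.
have [fg|/ltnW fg] := leqP (f n) (g n).
  rewrite ger0_norm; last by rewrite tE divr_ge0 ?ler0n // subr_ge0 ler_nat.
  by rewrite natrB // -tE; lra.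
rewrite ler0_norm; last first.
  by rewrite tE mulr_le0_ge0 ?invr_ge0 ?ler0n // subr_le0 ler_nat.
by rewrite (eqP fg) mul0r subrr mulr0.
Unshelve. all: by end_near.
Qed.

Unset Implicit Arguments. Set Strict Implicit.

Theorem theorem1 (R : realType) (q : nat) (b r : R)
    (L : nat -> finFieldType) (m rho : nat -> nat) :
  prime_power q -> 0 < b ->
  (forall n, 0 < m n)%N ->
  (forall n, #|L n| = q ^ m n)%N ->
  ((fun n => n%:R / (m n)%:R : R) @ \oo --> b) ->
  ((fun n => (rho n)%:R / n%:R : R) @ \oo --> r) ->
  0 <= r -> r <= Num.min 1 b^-1 ->
  limn_einf (fun n => ((ln ((@KR (L n) q n (rho n))%:R : R) / ((m n)%:R * ln (q%:R)))
                        / n%:R)%:E)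
  = ((1 - r) * (1 - b * r))%:E.
Proof.
move=> q_pp b_gt0 m_gt0 cardL nm_b rn_r r_ge0.
rewrite le_min => /andP[r_le1 r_leb].
(* With r <= 1 and br <= 1 both truncated differences, n - rho and m - rho, fall under
   [cvg_subn_ratio]. *)
have br_le1 : b * r <= 1 by rewrite mulrC -ler_pdivlMr // div1r.
have rm_br : (fun n => (rho n)%:R / (m n)%:R : R) @ \oo --> b * r.
  apply: cvg_trans (cvgM nm_b rn_r); apply: near_eq_cvg; near=> n.
  have n_neq0 : n%:R != 0 :> R by rewrite pnatr_eq0 -lt0n; near: n; exact: nbhs_infty_gt.
  by rewrite /= mulrC mulrA divfK.
have invm_0 : (fun n => (m n)%:R^-1 : R) @ \oo --> 0.
  have inv_0 : (fun n => n%:R^-1 : R) @ \oo --> 0.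
    by rewrite -cvg_shiftS; exact: cvg_harmonic.
  rewrite -[0](mulr0 b).
  apply: cvg_trans (cvgM nm_b inv_0); apply: near_eq_cvg; near=> n.
  have n_neq0 : n%:R != 0 :> R by rewrite pnatr_eq0 -lt0n; near: n; exact: nbhs_infty_gt.
  by rewrite /= mulrAC divff // mul1r.
(* [T] is the normalized main term; the error n ln q, divided by mn ln q, is 1/m, which tends to
   0. *)
pose T n : R := (n - rho n)%:R / n%:R * ((m n - rho n)%:R / (m n)%:R).
have T_lim : T @ \oo --> (1 - r) * (1 - b * r).
  by apply: cvgM; apply: cvg_subn_ratio => //; near=> n.
(* The sequence actually converges, so its lower limit is its limit. *)
apply: (fun h => (cvg_limn_einf_sup h).1).
apply: cvg_EFin; first by near=> n.
apply: (@squeeze_cvgr _ _ _ _ (fun n => T n - (m n)%:R^-1) (fun n => T n + (m n)%:R^-1)).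
- near=> n.
  have n_gt0 : 0 < n%:R :> R by rewrite ltr0n; near: n; exact: nbhs_infty_gt.
  have mn_gt0 : 0 < (m n)%:R :> R by rewrite ltr0n.
  have lnq_gt0 : 0 < ln (q%:R : R) by rewrite ln_gt0 // ltr1n prime_power_gt1.
  have den_gt0 : 0 < (m n)%:R * ln q%:R * n%:R :> R by rewrite !mulr_gt0.
  have /andP[lo hi] := ln_KR_bounds R n (rho n) q_pp (cardL n).
  rewrite /=; set lnK := ln (KR _ _ _ _)%:R in lo hi *.
  have -> : lnK / ((m n)%:R * ln q%:R) / n%:R = lnK / ((m n)%:R * ln q%:R * n%:R).
    by rewrite -mulrA -invfM.
  rewrite ler_pdivlMr // ler_pdivrMr //.
  rewrite natrM in lo, hi.
  have mE : (m n)%:R^-1 * ((m n)%:R * ln q%:R * n%:R) = n%:R * ln q%:R :> R.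
    by rewrite !mulrA mulVf ?gt_eqF // mul1r mulrC.
  have TE : T n * ((m n)%:R * ln q%:R * n%:R) =
      (m n - rho n)%:R * (n - rho n)%:R * ln q%:R :> R.
    by rewrite /T; field; rewrite ?gt_eqF.
  by rewrite mulrBl mulrDl mE TE lo hi.
- by rewrite -[X in _ --> X]subr0; apply: cvgB.
- by rewrite -[X in _ --> X]addr0; apply: cvgD.
Unshelve. all: by end_near.
Qed.
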